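(* Let $G$ be a profinite group and $H<G$ a subgroup. Let $\{g_\delta\}_{\delta\in\Delta}$ be a set of representatives of the right cosets of $H$ in $G$, let $h\in Z(H)$, and suppose that $G$ is topologically generated by $\{g_\delta^{-1}hg_\delta\}_{\delta\in\Delta}$. Then $Q_{G,H,h}$ is an algebraically connected profinite quandle.
   Context: A quandle $(Q,\triangleleft,\triangleleft^{-1})$ is a set with two binary operations such that for all $x,y,z$: $x\triangleleft x=x$; $(x\triangleleft y)\triangleleft^{-1}y=x=(x\triangleleft^{-1}y)\triangleleft y$; $(x\triangleleft y)\triangleleft z=(x\triangleleft z)\triangleleft(y\triangleleft z)$. For a group $G$, a subgroup $H$ and $h$ in the center $Z(H)$ of $H$, the right coset quandle $Q_{G,H,h}$ is the set $H\backslash G$ of right cosets with $Hg\triangleleft Hk:=Hgk^{-1}hk$ and $Hg\triangleleft^{-1}Hk:=Hgk^{-1}h^{-1}k$. A subset $S$ of a topological group $G$ topologically generates $G$ if the closure of the subgroup generated by $S$ equals $G$. For $y$ in a quandle $Q$ the symmetry $S_y(x)=x\triangleleft y$ is a quandle automorphism, and $\mathrm{Inn}(Q):=\langle S_y\rangle_{y\in Q}$, regarded as acting on $Q$ on the right. A quandle is profinite if it is (isomorphic to) the inverse limit $\varprojlim Q_\lambda$ of an inverse system, over a directed poset, of finite quandles and quandle homomorphisms (maps preserving $\triangleleft$), with coordinatewise operations and projections $\pi_\lambda$. Standing convention: the homomorphisms in an inverse system are surjective. $\widehat{\mathrm{Inn}(Q)}$ is the profinite completion of the group $\mathrm{Inn}(Q)$.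 It acts (on the right) on $Q=\varprojlim Q_\lambda$: each homomorphism $\mathrm{Inn}(Q)\to\mathrm{Inn}(Q_\lambda)$, $S_x\mapsto S_{\pi_\lambda(x)}$, extends uniquely to a continuous homomorphism $\widehat{\mathrm{Inn}(Q)}\to\mathrm{Inn}(Q_\lambda)$, $g\mapsto g_\lambda$, and $(q_\lambda)_\lambda\cdot g=(q_\lambda\cdot g_\lambda)_\lambda$. A profinite quandle $Q$ is (profinitely) algebraically connected if there is a single orbit under the action of $\widehat{\mathrm{Inn}(Q)}$.
   Formalization: The subgroup H is assumed closed in G; for an arbitrary subgroup the claim fails, e.g. G = Z_p, H = Z, h = 1 gives the trivial quandle on Z_p/Z, which is not algebraically connected. *)

(* Defs.v *)
From HB Require Import structures.
From mathcomp Require Import all_boot all_order.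
From mathcomp Require Import generic_quotient.
From mathcomp Require Import boolp classical_sets functions cardinality.
From mathcomp Require Import topology.

Set Implicit Arguments.
Unset Strict Implicit.
Unset Printing Implicit Defensive.

Local Open Scope quotient_scope.
Local Open Scope classical_set_scope.
Local Open Scope group_scope.

Declare Scope quandle_scope.
Delimit Scope quandle_scope with Q.
Local Open Scope quandle_scope.

HB.mixin Record isQuandle Q := {
  qop : Q -> Q -> Q;
  qinv : Q -> Q -> Q;
  qopxx : forall x, qop x x = x;
  qopK : forall x y, qinv (qop x y) y = x;
  qinvK : forall x y, qop (qinv x y) y = x;
  qopD : forall x y z, qop (qop x y) z = qop (qop x z) (qop y z)
}.

#[short(type="quandleType")]
HB.structure Definition Quandle := {Q of Choice Q & isQuandle Q}.

Notation "x <| y" := (qop x y) (at level 50, left associativity) : quandle_scope.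
Notation "x <|^-1 y" := (qinv x y) (at level 50, left associativity) : quandle_scope.

Lemma qinvE (Q : quandleType) (x y z : Q) : z <| y = x -> z = x <|^-1 y.
Proof. by move=> <-; rewrite qopK. Qed.

(* No continuity of the operations is required here: in [profinite_group] and
   [profinite_quandle] below it follows from the homeomorphism with an inverse
   limit of finite discrete groups or quandles. *)
#[short(type="preTopologicalGroupType")]
HB.structure Definition PreTopologicalGroup := {G of Topological G & Group G}.

#[short(type="preTopologicalQuandleType")]
HB.structure Definition PreTopologicalQuandle := {Q of Topological Q & Quandle Q}.

Definition homeomorphism (X Y : topologicalType) (f : X -> Y) : Prop :=
  exists g : Y -> X, [/\ cancel f g, cancel g f, continuous f & continuous g].

Definition generated (G : groupType) (A : set G) : set G :=
  smallest [set B : set G | group_closed (mem B)] A.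

Lemma generated_group_closed (G : groupType) (A : set G) :
  group_closed (mem (generated A)).
Proof.
split=> [|x y]; first by apply/mem_set => B [[/set_mem B1 _] _].
move=> /set_mem xA /set_mem yA; apply/mem_set => B /[dup] BA [[_ BF] _].
by apply/set_mem/BF; apply/mem_set; [exact: xA|exact: yA].
Qed.

Definition topologically_generates (G : preTopologicalGroupType) (A : set G) :=
  closure (generated A) = [set: G].

Definition center (G : groupType) (H : groupClosed G) : set G :=
  [set h | h \in H /\ forall k, k \in H -> commute h k].

Section RightCosets.
Context {G : groupType} (H : groupClosed G).

(* [Hx = Hy] iff [x y^-1] lies in [H]. *)
Definition coset_rel : rel G := fun x y => x / y \in H.

Lemma coset_rel_equiv : equiv_class_of coset_rel.
Proof.
split=> [x|x y|y x z]; rewrite /coset_rel; first by rewrite mulgV gpred1.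
  by rewrite gpredFC.
by move=> xy yz; rewrite -(mulgVK y x) -mulgA gpredM.
Qed.

Canonical coset_equiv := EquivRelPack coset_rel_equiv.

Definition right_cosets : Type := {eq_quot coset_equiv}.
HB.instance Definition _ := Choice.copy right_cosets {eq_quot coset_equiv}.
HB.instance Definition _ := EqQuotient.copy right_cosets {eq_quot coset_equiv}.

Lemma right_cosetsP x y :
  reflect (\pi_right_cosets x = \pi_right_cosets y) (x / y \in H).
Proof. by apply: (iffP idP) => [?|]; [apply/eqmodP|move/eqmodP]. Qed.

End RightCosets.
Arguments right_cosets {G} H.

Section CosetQuandle.
Context {G : preTopologicalGroupType} {H : groupClosed G} {h : G}.

Definition coset_quandle of center H h : Type :=
  quotient_topology (right_cosets H).

Variable hZ : center H h.
Local Notation Q := (coset_quandle hZ).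

HB.instance Definition _ :=
  Topological.copy Q (quotient_topology (right_cosets H)).
HB.instance Definition _ :=
  Quotient.copy Q (quotient_topology (right_cosets H)).

Definition coset_twist (u : G) (a b : Q) : Q :=
  \pi_Q (repr a * (repr b)^-1 * u * repr b).

Lemma coset_quandleP x y : reflect (\pi_Q x = \pi_Q y) (x / y \in H).
Proof. exact: right_cosetsP. Qed.

Lemma coset_twistE u x y : center H u ->
  coset_twist u (\pi_Q x) (\pi_Q y) = \pi_Q (x * y^-1 * u * y).
Proof.
move=> [uH cu]; rewrite /coset_twist; apply/esym/coset_quandleP.
have /coset_quandleP := esym (reprK (\pi_Q x)).
have /coset_quandleP := esym (reprK (\pi_Q y)).
set y' := repr (\pi_Q y); set x' := repr (\pi_Q x) => yH xH.
have assoc (a b : G) : a * b^-1 * u * b = a * (b^-1 * (u * b)).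
  by rewrite !mulgA.
suff E : y^-1 * (u * y) = y'^-1 * (u * y') by rewrite !assoc E mulgKA.
have -> : y = (y / y') * y' by rewrite mulgVK.
move: (y / y') yH => k /cu uk; rewrite invgM -mulgA; congr (_ * _).
by rewrite (mulgA u) uk -mulgA mulKg.
Qed.

Lemma center_inv : center H h^-1.
Proof.
case: hZ => hH ch; split=> [|k kH]; first by rewrite gpredV.
exact/esym/commuteV/esym/ch.
Qed.

Lemma coset_opE x y :
  coset_twist h (\pi_Q x) (\pi_Q y) = \pi_Q (x * y^-1 * h * y).
Proof. exact: coset_twistE. Qed.

Lemma coset_invE x y :
  coset_twist h^-1 (\pi_Q x) (\pi_Q y) = \pi_Q (x * y^-1 * h^-1 * y).
Proof. exact/coset_twistE/center_inv. Qed.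

Let coset_opxx x : coset_twist h x x = x.
Proof.
elim/quotW: x => x; rewrite coset_opE mulgV mul1g; apply/coset_quandleP.
by rewrite mulgK; case: hZ.
Qed.

Let coset_opK x y : coset_twist h^-1 (coset_twist h x y) y = x.
Proof.
elim/quotW: x => x; elim/quotW: y => y.
by rewrite coset_opE coset_invE mulgK mulgK mulgVK.
Qed.

Let coset_invK x y : coset_twist h (coset_twist h^-1 x y) y = x.
Proof.
elim/quotW: x => x; elim/quotW: y => y.
by rewrite coset_invE coset_opE mulgK mulgVK mulgVK.
Qed.

Let coset_opD x y z : coset_twist h (coset_twist h x y) z =
  coset_twist h (coset_twist h x z) (coset_twist h y z).
Proof.
elim/quotW: x => x; elim/quotW: y => y; elim/quotW: z => z.
rewrite (coset_opE x y) (coset_opE x z) (coset_opE y z) !coset_opE.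
by congr (\pi_Q _); rewrite !invgM !invgK !mulgA !mulgK !mulgVK.
Qed.

HB.instance Definition _ :=
  isQuandle.Build Q coset_opxx coset_opK coset_invK coset_opD.

Lemma coset_quandle_opE x y :
  \pi_Q x <| \pi_Q y = \pi_Q (x * y^-1 * h * y).
Proof. exact: coset_opE. Qed.

Lemma coset_quandle_invE x y :
  \pi_Q x <|^-1 \pi_Q y = \pi_Q (x * y^-1 * h^-1 * y).
Proof. exact: coset_invE. Qed.

End CosetQuandle.

(* Inverse systems are surjective by convention; [discrete_topology] below makes
   [inverse_limit] a subspace of a product of discrete spaces. *)
Record inverse_system d (I : porderType d) (T : I -> choiceType) :=
  InverseSystem {
    transition :> forall i j : I, (i <= j)%O -> T j -> T i;
    index_inhabited : exists i : I, True;
    index_directed : forall i j : I, exists k, (i <= k)%O /\ (j <= k)%O;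
    transition_id : forall i (ii : (i <= i)%O) x, transition ii x = x;
    transition_comp : forall i j k (ij : (i <= j)%O) (jk : (j <= k)%O)
      (ik : (i <= k)%O) x, transition ij (transition jk x) = transition ik x;
    transition_surj : forall i j (ij : (i <= j)%O) x,
      exists y, transition ij y = x
  }.

Definition inverse_limit d (I : porderType d) (T : I -> choiceType)
    (S : inverse_system T) :
    set (prod_topology (fun i => discrete_topology (T i))) :=
  [set x | forall i j (ij : (i <= j)%O), S i j ij (x j) = x i].

Record finite_group_system d (I : porderType d) (T : I -> groupType) :=
  FiniteGroupSystem {
    group_sys :> inverse_system T;
    group_sys_finite : forall i, finite_set [set: T i];
    group_sysM : forall i j (ij : (i <= j)%O),
      {morph group_sys i j ij : x y / x * y}
  }.

Section GroupLimit.
Context {d} {I : porderType d} {T : I -> groupType}.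
Variable S : finite_group_system T.

Definition group_limit : Type := inverse_limit S.
HB.instance Definition _ := Topological.copy group_limit (inverse_limit S).

Definition group_proj i (x : group_limit) : T i := set_val x i.

Lemma group_projE i j (ij : (i <= j)%O) (x : group_limit) :
  S i j ij (group_proj j x) = group_proj i x.
Proof. exact: (set_valP x). Qed.

Lemma group_limit_eq (x y : group_limit) :
  (forall i, group_proj i x = group_proj i y) -> x = y.
Proof. by move=> xy; apply/val_inj/functional_extensionality_dep. Qed.

Lemma group_sys1 i j (ij : (i <= j)%O) : S i j ij 1 = 1.
Proof. by apply: (@mulgI _ (S i j ij 1)); rewrite -group_sysM !mulg1. Qed.

Lemma group_sysV i j (ij : (i <= j)%O) x : S i j ij x^-1 = (S i j ij x)^-1.
Proof.
by apply/esym/mulg1_eq; rewrite -group_sysM mulgV group_sys1.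
Qed.

Program Definition group_limit_one : group_limit :=
  @SigSub _ _ _ (fun i => 1 : T i) _.
Next Obligation. by apply/mem_set => i j ij; exact: group_sys1. Qed.

Program Definition group_limit_inv (x : group_limit) : group_limit :=
  @SigSub _ _ _ (fun i => (group_proj i x)^-1) _.
Next Obligation.
by move=> x; apply/mem_set => i j ij; rewrite group_sysV group_projE.
Qed.

Program Definition group_limit_mul (x y : group_limit) : group_limit :=
  @SigSub _ _ _ (fun i => group_proj i x * group_proj i y) _.
Next Obligation.
by move=> x y; apply/mem_set => i j ij; rewrite group_sysM !group_projE.
Qed.

Let group_limit_mulA : associative group_limit_mul.
Proof. by move=> x y z; apply: group_limit_eq => i; exact: mulgA. Qed.
Let group_limit_mul1g : left_id group_limit_one group_limit_mul.
Proof. by move=> x; apply: group_limit_eq => i; exact: mul1g. Qed.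
Let group_limit_mulg1 : right_id group_limit_one group_limit_mul.
Proof. by move=> x; apply: group_limit_eq => i; exact: mulg1. Qed.
Let group_limit_mulVg :
  left_inverse group_limit_one group_limit_inv group_limit_mul.
Proof. by move=> x; apply: group_limit_eq => i; exact: mulVg. Qed.
Let group_limit_mulgV :
  right_inverse group_limit_one group_limit_inv group_limit_mul.
Proof. by move=> x; apply: group_limit_eq => i; exact: mulgV. Qed.

HB.instance Definition _ := isGroup.Build group_limit group_limit_mulA
  group_limit_mul1g group_limit_mulg1 group_limit_mulVg group_limit_mulgV.
End GroupLimit.

Definition profinite_group (G : preTopologicalGroupType) : Prop :=
  exists d (I : porderType d) (T : I -> groupType)
    (S : finite_group_system T) (f : G -> group_limit S),
    {morph f : x y / x * y} /\ homeomorphism f.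

Record finite_quandle_system d (I : porderType d) (T : I -> quandleType) :=
  FiniteQuandleSystem {
    quandle_sys :> inverse_system T;
    quandle_sys_finite : forall i, finite_set [set: T i];
    quandle_sysM : forall i j (ij : (i <= j)%O),
      {morph quandle_sys i j ij : x y / x <| y}
  }.

Section QuandleLimit.
Context {d} {I : porderType d} {T : I -> quandleType}.
Variable S : finite_quandle_system T.

Definition quandle_limit : Type := inverse_limit S.
HB.instance Definition _ := Topological.copy quandle_limit (inverse_limit S).

Definition quandle_proj i (x : quandle_limit) : T i := set_val x i.

Lemma quandle_projE i j (ij : (i <= j)%O) (x : quandle_limit) :
  S i j ij (quandle_proj j x) = quandle_proj i x.
Proof. exact: (set_valP x). Qed.

Lemma quandle_limit_ext (x y : quandle_limit) :
  (forall i, quandle_proj i x = quandle_proj i y) -> x = y.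
Proof. by move=> xy; apply/val_inj/functional_extensionality_dep. Qed.

Lemma quandle_sysV i j (ij : (i <= j)%O) x y :
  S i j ij (x <|^-1 y) = S i j ij x <|^-1 S i j ij y.
Proof. by apply: qinvE; rewrite -quandle_sysM qinvK. Qed.

Program Definition quandle_limit_op (x y : quandle_limit) : quandle_limit :=
  @SigSub _ _ _ (fun i => quandle_proj i x <| quandle_proj i y) _.
Next Obligation.
by move=> x y; apply/mem_set => i j ij; rewrite quandle_sysM !quandle_projE.
Qed.

Program Definition quandle_limit_inv (x y : quandle_limit) : quandle_limit :=
  @SigSub _ _ _ (fun i => quandle_proj i x <|^-1 quandle_proj i y) _.
Next Obligation.
by move=> x y; apply/mem_set => i j ij; rewrite quandle_sysV !quandle_projE.
Qed.

Let quandle_limit_opxx x : quandle_limit_op x x = x.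
Proof. by apply: quandle_limit_ext => i; exact: qopxx. Qed.
Let quandle_limit_opK x y : quandle_limit_inv (quandle_limit_op x y) y = x.
Proof. by apply: quandle_limit_ext => i; exact: qopK. Qed.
Let quandle_limit_invK x y : quandle_limit_op (quandle_limit_inv x y) y = x.
Proof. by apply: quandle_limit_ext => i; exact: qinvK. Qed.
Let quandle_limit_opD x y z : quandle_limit_op (quandle_limit_op x y) z =
  quandle_limit_op (quandle_limit_op x z) (quandle_limit_op y z).
Proof. by apply: quandle_limit_ext => i; exact: qopD. Qed.

HB.instance Definition _ := isQuandle.Build quandle_limit quandle_limit_opxx
  quandle_limit_opK quandle_limit_invK quandle_limit_opD.
End QuandleLimit.

Record profinite_presentation (Q : preTopologicalQuandleType) :=
  ProfinitePresentation {
    pres_disp : Order.disp_t;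
    pres_idx : porderType pres_disp;
    pres_obj : pres_idx -> quandleType;
    pres_sys : finite_quandle_system pres_obj;
    pres_iso : Q -> quandle_limit pres_sys;
    pres_isoM : {morph pres_iso : x y / x <| y};
    pres_homeo : homeomorphism pres_iso
  }.

Record sym (T : Type) := Sym {
  sym_fun :> T -> T;
  sym_inv : T -> T;
  sym_funK : cancel sym_fun sym_inv;
  sym_invK : cancel sym_inv sym_fun
}.

HB.instance Definition _ (T : Type) := gen_eqMixin (sym T).
HB.instance Definition _ (T : Type) := gen_choiceMixin (sym T).

Section SymGroup.
Variable T : Type.
Implicit Types s t : sym T.

Lemma sym_eq s t : s =1 t -> s = t.
Proof.
case: s t => [s s' sK s'K] [t t' tK t'K] /= /funext est; subst t.
have est : s' = t' by apply/funext => x; rewrite -{1}(t'K x) sK.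
by subst t'; rewrite (Prop_irrelevance sK tK) (Prop_irrelevance s'K t'K).
Qed.

(* Permutations act on the right: [x . (s * t) = (x . s) . t]. *)
Definition sym_mul s t : sym T :=
  Sym (can_comp (sym_funK t) (sym_funK s)) (can_comp (sym_invK s) (sym_invK t)).
Definition sym_one : sym T := @Sym T id id (frefl _) (frefl _).
Definition sym_opp s : sym T := Sym (sym_invK s) (sym_funK s).

Let sym_mulA : associative sym_mul. Proof. by move=> *; exact: sym_eq. Qed.
Let sym_mul1 : left_id sym_one sym_mul. Proof. by move=> *; exact: sym_eq. Qed.
Let sym_mulr1 : right_id sym_one sym_mul. Proof. by move=> *; exact: sym_eq. Qed.
Let sym_mulV : left_inverse sym_one sym_opp sym_mul.
Proof. by move=> s; apply: sym_eq => x; exact: sym_invK. Qed.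
Let sym_mulrV : right_inverse sym_one sym_opp sym_mul.
Proof. by move=> s; apply: sym_eq => x; exact: sym_funK. Qed.

HB.instance Definition _ :=
  isGroup.Build (sym T) sym_mulA sym_mul1 sym_mulr1 sym_mulV sym_mulrV.
End SymGroup.

Section Inn.
Variable Q : quandleType.

Definition symmetry (y : Q) : sym Q :=
  @Sym Q (qop^~ y) (qinv^~ y) (qopK^~ y) (qinvK^~ y).

Definition inn_pred : {pred sym Q} := mem (generated (range symmetry)).

Record Inn := InnOf { inn_sym :> sym Q; _ : inn_sym \in inn_pred }.
HB.instance Definition _ := [isSub for inn_sym].
HB.instance Definition _ := [Choice of Inn by <:].
HB.instance Definition _ := SubChoice_isSubGroup.Build (sym Q) inn_pred Inn
  (generated_group_closed (range symmetry)).

Lemma symmetry_inn y : symmetry y \in inn_pred.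
Proof. by apply/mem_set; apply: sub_gen_smallest; exists y. Qed.

Definition inn_symmetry (y : Q) : Inn := InnOf (symmetry_inn y).
End Inn.

Record finite_index_normal (G : groupType) := FiniteIndexNormal {
  fin_sub :> groupClosed G;
  fin_normal : forall x y, x \in fin_sub -> x ^ y \in fin_sub;
  fin_finite : finite_set [set: right_cosets fin_sub]
}.

HB.instance Definition _ G := gen_eqMixin (finite_index_normal G).
HB.instance Definition _ G := gen_choiceMixin (finite_index_normal G).

Section FiniteIndexNormal.
Variable G : groupType.
Implicit Types N M : finite_index_normal G.

Lemma fin_index_eq N M : (forall x, (x \in N) = (x \in M)) -> N = M.
Proof.
case: N M => [[S [[nV] [n1] [nM]]] nJ nf] [[S' [[mV] [m1] [mM]]] mJ mf] /=.
move=> SS'; have : S = S' by apply/funext => x; have := SS' x.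
move=> ?; subst S'; move: mJ mf; rewrite (Prop_irrelevance mV nV).
rewrite (Prop_irrelevance m1 n1) (Prop_irrelevance mM nM) => mJ mf.
by rewrite (Prop_irrelevance mJ nJ) (Prop_irrelevance mf nf).
Qed.

(* Ordered by reverse inclusion, so that [G / M] maps onto [G / N] whenever
   [N <= M]. *)
Definition fin_le N M := `[< {subset M <= N} >].

Let fin_le_refl : reflexive fin_le. Proof. by move=> N; exact/asboolP. Qed.
Let fin_le_anti : antisymmetric fin_le.
Proof.
move=> N M /andP[/asboolP MN /asboolP NM]; apply: fin_index_eq => x.
by apply/idP/idP => [/NM|/MN].
Qed.
Let fin_le_trans : transitive fin_le.
Proof.
by move=> M N L /asboolP MN /asboolP LM; apply/asboolP => x /LM /MN.
Qed.

Fact fin_display : Order.disp_t. Proof. exact: Order.Disp tt tt. Qed.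

HB.instance Definition _ := Order.Le_isPOrder.Build fin_display
  (finite_index_normal G) fin_le_refl fin_le_anti fin_le_trans.

Lemma fin_leP N M : reflect {subset M <= N} (N <= M)%O.
Proof. exact: asboolP. Qed.
End FiniteIndexNormal.

Section QuotientGroup.
Context {G : groupType}.

Definition quotient_group (N : finite_index_normal G) : Type := right_cosets N.

Variable N : finite_index_normal G.
Local Notation GN := (quotient_group N).

HB.instance Definition _ := Choice.copy GN (right_cosets N).
HB.instance Definition _ := EqQuotient.copy GN (right_cosets N).

Lemma quotient_groupP (x y : G) :
  reflect (\pi_GN x = \pi_GN y) (x / y \in N).
Proof. exact: right_cosetsP. Qed.

Definition quotient_mul (a b : GN) : GN := \pi_GN (repr a * repr b).
Definition quotient_inv (a : GN) : GN := \pi_GN (repr a)^-1.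

Let reprP x : repr (\pi_GN x) / x \in N.
Proof. by apply/quotient_groupP; rewrite reprK. Qed.

Let quotient_mulE x y :
  quotient_mul (\pi_GN x) (\pi_GN y) = \pi_GN (x * y).
Proof.
rewrite /quotient_mul; apply/quotient_groupP; rewrite invgM -mulgA.
have := reprP x; have := reprP y; set y' := repr _; set x' := repr _ => yN xN.
have -> : x' * (y' * (y^-1 * x^-1)) = (y' / y) ^ x'^-1 * (x' / x).
  by rewrite conjgE invgK !mulgA mulgVK.
by rewrite gpredM// fin_normal.
Qed.

Let quotient_invE x : quotient_inv (\pi_GN x) = \pi_GN x^-1.
Proof.
apply/quotient_groupP; rewrite invgK; have := reprP x; set x' := repr _ => xN.
have -> : x'^-1 * x = ((x' / x) ^ x')^-1.
  by rewrite conjgE !invgM !invgK !mulgA mulgVK.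
by rewrite gpredV fin_normal.
Qed.

Let quotient_mulA : associative quotient_mul.
Proof.
elim/quotW => x; elim/quotW => y; elim/quotW => z.
by rewrite (quotient_mulE y z) (quotient_mulE x y) !quotient_mulE mulgA.
Qed.
Let quotient_mul1g : left_id (\pi_GN 1) quotient_mul.
Proof. by elim/quotW => x; rewrite quotient_mulE mul1g. Qed.
Let quotient_mulg1 : right_id (\pi_GN 1) quotient_mul.
Proof. by elim/quotW => x; rewrite quotient_mulE mulg1. Qed.
Let quotient_mulVg : left_inverse (\pi_GN 1) quotient_inv quotient_mul.
Proof. by elim/quotW => x; rewrite quotient_invE quotient_mulE mulVg. Qed.
Let quotient_mulgV : right_inverse (\pi_GN 1) quotient_inv quotient_mul.
Proof. by elim/quotW => x; rewrite quotient_invE quotient_mulE mulgV. Qed.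

HB.instance Definition _ := isGroup.Build GN quotient_mulA quotient_mul1g
  quotient_mulg1 quotient_mulVg quotient_mulgV.

Lemma quotient_piM x y : \pi_GN (x * y) = \pi_GN x * \pi_GN y.
Proof. exact/esym/quotient_mulE. Qed.
End QuotientGroup.

Section CompletionSystem.
Variable G : groupType.
Local Notation I := (finite_index_normal G).

Definition quotient_map (N M : I) (_ : (N <= M)%O) (a : quotient_group M) :
  quotient_group N := \pi_(quotient_group N) (repr a).

Lemma quotient_mapE (N M : I) (NM : (N <= M)%O) x :
  quotient_map NM (\pi_(quotient_group M) x) = \pi_(quotient_group N) x.
Proof.
apply/quotient_groupP; move/fin_leP: (NM); apply.
by apply/quotient_groupP; rewrite reprK.
Qed.

Definition fin_cap_pred (N M : I) : {pred G} := [predI N & M].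

Let fin_capP N M x : x \in fin_cap_pred N M = (x \in N) && (x \in M).
Proof. by []. Qed.

Let fin_capM N M : mulg_closed (fin_cap_pred N M).
Proof.
by move=> x y; rewrite !fin_capP => /andP[? ?] /andP[? ?]; rewrite !gpredM.
Qed.
Let fin_cap1 N M : 1 \in fin_cap_pred N M.
Proof. by rewrite fin_capP !gpred1. Qed.
Let fin_capV N M : invg_closed (fin_cap_pred N M).
Proof. by move=> x; rewrite !fin_capP !gpredV. Qed.

HB.instance Definition _ N M := isMulClosed.Build G _ (@fin_capM N M).
HB.instance Definition _ N M := isMul1Closed.Build G _ (@fin_cap1 N M).
HB.instance Definition _ N M := isInvClosed.Build G _ (@fin_capV N M).

Let fin_cap_normal N M x y :
  x \in fin_cap_pred N M -> x ^ y \in fin_cap_pred N M.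
Proof.
by rewrite !fin_capP => /andP[xN xM]; apply/andP; split; exact: fin_normal.
Qed.

Let fin_cap_finite N M : finite_set [set: right_cosets (fin_cap_pred N M)].
Proof.
pose f (a : right_cosets (fin_cap_pred N M)) :=
  (\pi_(right_cosets N) (repr a), \pi_(right_cosets M) (repr a)).
have f_inj : injective f.
  move=> a b [] /right_cosetsP abN /right_cosetsP abM.
  rewrite -[a]reprK -[b]reprK; apply/right_cosetsP.
  by rewrite fin_capP; apply/andP.
rewrite (_ : [set: _] = f @^-1` ([set: _] `*` [set: _])); last exact/seteqP.
apply: finite_preimage => [? ? _ _ /f_inj//|].
by apply: finite_setX; exact: fin_finite.
Qed.

Definition fin_cap N M : I :=
  @FiniteIndexNormal G (fin_cap_pred N M) (@fin_cap_normal N M)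
    (fin_cap_finite N M).

Definition fin_top_pred : {pred G} := predT.

Let fin_topM : mulg_closed fin_top_pred. Proof. by []. Qed.
Let fin_top1 : 1 \in fin_top_pred. Proof. by []. Qed.
Let fin_topV : invg_closed fin_top_pred. Proof. by []. Qed.

HB.instance Definition _ := isMulClosed.Build G fin_top_pred fin_topM.
HB.instance Definition _ := isMul1Closed.Build G fin_top_pred fin_top1.
HB.instance Definition _ := isInvClosed.Build G fin_top_pred fin_topV.

Let fin_top_finite : finite_set [set: right_cosets fin_top_pred].
Proof.
apply: (@sub_finite_set _ _ [set \pi_(right_cosets fin_top_pred) 1]).
  by move=> a _ /=; rewrite -[a]reprK; exact/right_cosetsP.
exact: finite_set1.
Qed.

Definition fin_top : I :=
  @FiniteIndexNormal G fin_top_pred (fun _ _ _ => isT) fin_top_finite.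

Let index_directed (N M : I) : exists K, (N <= K)%O /\ (M <= K)%O.
Proof. by exists (fin_cap N M); split; apply/fin_leP => x /andP[]. Qed.

Let quotient_map_id (N : I) (NN : (N <= N)%O) a : quotient_map NN a = a.
Proof. by rewrite /quotient_map reprK. Qed.

Let quotient_map_comp (N M L : I) (NM : (N <= M)%O) (ML : (M <= L)%O)
  (NL : (N <= L)%O) a :
  quotient_map NM (quotient_map ML a) = quotient_map NL a.
Proof.
elim/quotW: a => x.
by rewrite (quotient_mapE ML) (quotient_mapE NM) (quotient_mapE NL).
Qed.

Let quotient_map_surj (N M : I) (NM : (N <= M)%O) a :
  exists b, quotient_map NM b = a.
Proof.
elim/quotW: a => x; exists (\pi_(quotient_group M) x).
exact: quotient_mapE.
Qed.

Let quotient_mapM (N M : I) (NM : (N <= M)%O) :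
  {morph quotient_map NM : a b / a * b}.
Proof.
elim/quotW => x; elim/quotW => y.
by rewrite -quotient_piM !(quotient_mapE NM) quotient_piM.
Qed.

Definition completion_system : finite_group_system quotient_group :=
  @FiniteGroupSystem _ I quotient_group
    (InverseSystem (ex_intro _ fin_top Logic.I) index_directed quotient_map_id
      quotient_map_comp quotient_map_surj)
    (@fin_finite G) quotient_mapM.

Definition profinite_completion : Type := group_limit completion_system.
HB.instance Definition _ :=
  PreTopologicalGroup.copy profinite_completion (group_limit completion_system).

Program Definition completion_map (x : G) : profinite_completion :=
  @SigSub _ _ _ (fun N : I => \pi_(quotient_group N) x) _.
Next Obligation.
by move=> x; apply/mem_set => N M NM; exact: quotient_mapE.
Qed.

Lemma completion_mapM : {morph completion_map : x y / x * y}.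
Proof.
by move=> x y; apply: group_limit_eq => N; exact: quotient_piM.
Qed.
End CompletionSystem.

Definition profinite_quandle (Q : preTopologicalQuandleType) : Prop :=
  inhabited (profinite_presentation Q).

Section Action.
Context {d} {I : porderType d} {T : I -> quandleType}.
Variable S : finite_quandle_system T.
Local Notation Q := (quandle_limit S).
Local Notation Inn_hat := (profinite_completion (Inn Q)).

(* [e] is the continuous extension [g |-> g_i] to the profinite completion of
   the homomorphism [Inn Q -> Inn (T i)] given by [S_x |-> S_(pi_i x)]. These
   conditions determine [e], since [Inn Q] has dense image in [Inn_hat]; hence
   [is_completion_action] determines [act]. *)
Definition extends_projection (i : I) (e : Inn_hat -> Inn (T i)) : Prop :=
  [/\ {morph e : g g' / g * g'},
      continuous (e : Inn_hat -> discrete_topology (Inn (T i))) &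
      forall x : Q,
        e (completion_map (inn_symmetry x)) = inn_symmetry (quandle_proj i x)].

(* [(x . g)_i = x_i . g_i], permutations of [T i] acting by evaluation. *)
Definition is_completion_action (act : Q -> Inn_hat -> Q) : Prop :=
  forall i, exists2 e : Inn_hat -> Inn (T i), extends_projection e &
    forall x g, quandle_proj i (act x g) = e g (quandle_proj i x).

Definition single_orbit : Prop :=
  exists2 act : Q -> Inn_hat -> Q, is_completion_action act &
    exists x : Q, range (act x) = [set: Q].
End Action.

(* Transitivity of the action does not depend on how the topological quandle [Q]
   is presented as an inverse limit; it is asserted for all presentations. *)
Definition algebraically_connected (Q : preTopologicalQuandleType) : Prop :=
  forall P : profinite_presentation Q, single_orbit (pres_sys P).

(* Main.v *)
Require Import Defs.
From HB Require Import structures.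
From mathcomp Require Import all_boot all_order.
From mathcomp Require Import generic_quotient.
From mathcomp Require Import boolp classical_sets functions cardinality.
From mathcomp Require Import topology.

(** Write [G] as the limit of finite groups [T i], with projections [p i].  The
images [p i H] and [p i h] define finite coset quandles [p i H \ T i], and
[H \ G] maps to their limit.  As [G] is compact, this map is surjective, and it
is injective because moreover [H] is closed.

For transitivity, [Inn Q] acts on each finite level through a finite quotient
(a symmetry of [Q] descends because the projections of [Q] are surjective), so
the action extends to the completion.  The symmetry of [H g_delta] is right
translation by [g_delta^-1 h g_delta]; these elements generate a dense subgroup,
so the [Inn Q]-orbit of the base coset is dense, and compactness of the
completion turns density into transitivity. *)

Set Implicit Arguments.
Unset Strict Implicit.
Unset Printing Implicit Defensive.

Import Order.POrderTheory.

Local Open Scope quotient_scope.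
Local Open Scope classical_set_scope.
Local Open Scope group_scope.

(** * Compactness and maps to discrete spaces *)

Lemma continuous_discreteP (X : topologicalType) (T : choiceType)
    (f : X -> discrete_topology T) :
  (forall x, nbhs x [set z | f z = f x]) -> continuous f.
Proof.
move=> f_loc x A fxA; apply: filterS (f_loc x) => z /= fzx.
by rewrite fzx; exact: (@nbhs_singleton (discrete_topology T)).
Qed.

(** By directedness the [K i] form a filter base. The filter that they generate has a cluster point,
    and each [K i], being closed, contains it. *)
Lemma compact_directed_bigcap (X : topologicalType) d (I : porderType d)
    (K : I -> set X) : compact [set: X] -> (exists i : I, True) ->
  (forall i j : I, exists k, (i <= k)%O /\ (j <= k)%O) ->
  (forall i j, (i <= j)%O -> K j `<=` K i) ->
  (forall i, closed (K i)) -> (forall i, K i !=set0) ->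
  exists x, forall i, K i x.
Proof.
move=> cptX [i0 _] I_dir K_mono K_closed K_neq0.
pose F := filter_from [set: I] K.
have F_filter : ProperFilter F.
  apply: filter_from_proper => [|i _]; last exact: K_neq0.
  apply: filter_from_filter; first by exists i0.
  move=> i j _ _; have [k [ik jk]] := I_dir i j.
  by exists k => // x Kx; split; [exact: K_mono ik _ Kx|exact: K_mono jk _ Kx].
have [|x [_ clx]] := cptX F F_filter; first by exists i0.
exists x => i; apply: K_closed => B xB.
by apply: clx => //; exists i.
Qed.

(** A filter on the subspace is pushed forward along [set_val]. A cluster point of the image filter
    in [A] clusters the original one, because open sets of the subspace are traces of open sets of
    [X]. *)
Lemma compact_set_type (X : topologicalType) (A : set X) :
  compact A -> compact [set: A].
Proof.
move=> cptA F F_filter _.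
have [|p [pA clp]] := cptA (set_val @ F) _.
  by apply: (@filterE _ F) => x; exact: set_valP.
exists (SigSub (mem_set pA)); split=> // U V FU [W [[W' oW' <-] pW] WV].
have [_ [[x Ux <-] xW]] : set_val @` U `&` W' !=set0.
  apply: clp; last exact: open_nbhs_nbhs.
  exact: (@filterS _ F _ U) (@preimage_image _ _ set_val U) FU.
by exists x; split=> //; exact: WV.
Qed.

(** * Inverse limits of finite discrete sets *)

Section InverseLimit.
Context {d} {I : porderType d} {T : I -> choiceType} (S : inverse_system T).
Local Notation prodT := (prod_topology (fun i => discrete_topology (T i))).
Hypothesis T_finite : forall i, finite_set [set: T i].

Let prod_proj_continuous i :
  continuous (fun x : prodT => x i : discrete_topology (T i)).
Proof. exact: (@proj_continuous I (fun i => discrete_topology (T i)) i). Qed.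

Lemma prod_discrete_compact : compact [set: prodT].
Proof.
have := @tychonoff I (fun i => discrete_topology (T i)) (fun=> setT).
have -> : [set f : forall i, T i | forall i, [set: T i] (f i)] = setT.
  by apply/seteqP.
by apply=> i; exact/finite_compact/T_finite.
Qed.

(** The condition involves only two coordinates, and both are locally constant, so its failure at a
    point persists nearby. *)
Let prod_rel_closed i j (P : T i -> T j -> Prop) :
  closed [set x : prodT | P (x i) (x j)].
Proof.
rewrite -[X in closed X]setCK; apply: open_closedC; rewrite openE => x /= xij.
have nx k : nbhs x [set z : prodT | z k = x k].
  exact: (@prod_proj_continuous k x [set x k]
    (@discrete_set1 (discrete_topology (T k)) (x k))).
by apply: filterS2 (nx i) (nx j) => z /= -> ->.
Qed.

Lemma inverse_limit_closed : closed (inverse_limit S).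
Proof.
move=> x clx i j ij.
apply: (@prod_rel_closed _ _ (fun xj xi => S i j ij xj = xi)) => B /clx.
by case=> y [yS By]; exists y; split=> //; exact: yS.
Qed.

Lemma inverse_limit_compact : compact [set: inverse_limit S].
Proof.
apply: compact_set_type.
exact: subclosed_compact inverse_limit_closed prod_discrete_compact _.
Qed.

Lemma inverse_limit_proj_continuous i :
  continuous (fun x : inverse_limit S => set_val x i : discrete_topology (T i)).
Proof.
move=> x; apply: (@continuous_comp _ prodT _ set_val (fun x => x i)).
  exact: initial_continuous.
exact: prod_proj_continuous.
Qed.

Lemma inverse_limit_continuous (X : topologicalType)
    (f : X -> inverse_limit S) :
  (forall i, continuous (fun x => set_val (f x) i : discrete_topology (T i))) ->
  continuous f.
Proof.
move=> f_cts; apply/continuousP => _ [A oA <-]; move: A oA.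
(* The product topology is the supremum of the topologies induced by the coordinates, so one
   coordinate is checked at a time. *)
apply/continuousP => x; apply/cvg_sup => i A [_ [[B oB <-] Bx] BA].
apply: filterS BA _.
have /continuousP/(_ B oB) := f_cts i; rewrite openE; exact.
Qed.

(* The closed sets [K j] of families that are compatible below [j] and lie over
   [t] are nonempty and decreasing, and their intersection is the fiber over
   [t]. *)
Lemma inverse_limit_proj_surj i (t : T i) :
  exists x : inverse_limit S, set_val x i = t.
Proof.
pose K j := [set x : prodT |
  (forall k (kj : (k <= j)%O), S k j kj (x j) = x k) /\
  forall ij : (i <= j)%O, S i j ij (x j) = t].
have lift_t j : exists k, exists2 z : T k, (j <= k)%O &
    exists2 ik : (i <= k)%O, True & S i k ik z = t.
  have [k [ik jk]] := index_directed S i j.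
  by have [z zt] := transition_surj S ik t; exists k, z => //; exists ik.
have T_inh j : exists u : T j, True.
  by have [k [z jk _]] := lift_t j; exists (S j k jk z).
pose u j := projT1 (cid (T_inh j)).
have [] := @compact_directed_bigcap prodT d I K prod_discrete_compact.
- exact: index_inhabited S.
- exact: index_directed S.
- move=> j k jk x [xk xt]; split=> [l lj|ij].
    have lk := le_trans lj jk.
    by rewrite -(xk _ jk) (transition_comp S lj jk lk) xk.
  have ik := le_trans ij jk.
  by rewrite -(xk _ jk) (transition_comp S ij jk ik).
- move=> j x clx; split=> [k kj|ij].
    apply: (@prod_rel_closed _ _ (fun xj xk => S k j kj xj = xk)) => B /clx.
    by case=> y [[yk _] By]; exists y; split=> //; exact: yk.
  apply: (@prod_rel_closed _ _ (fun xj (_ : T j) => S i j ij xj = t)) => B /clx.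
  by case=> y [[_ yt] By]; exists y; split=> //; exact: yt.
- move=> j; have [k [z jk [ik _ zt]]] := lift_t j.
  (* With [k] above both [i] and [j], a lift [z] of [t] to [T k] is pushed down to every level below
     [k]. Other levels get an arbitrary value [u l], since [K j] only constrains levels below
     [j]. *)
  exists (fun l => if pselect (l <= k)%O is left lk then S l k lk z else u l).
  split=> [l lj|ij].
    case: pselect => [jk'|//]; case: pselect => [lk|]; last first.
      by have := le_trans lj jk.
    exact: transition_comp.
  case: pselect => [jk'|//]; rewrite (transition_comp S ij jk' ik).
  exact: zt.
move=> x xK; have xS : x \in inverse_limit S.
  by apply/mem_set => j k jk; have [] := xK k; exact.
exists (SigSub xS); have [_ /(_ (lexx i))] := xK i.
by rewrite transition_id.
Qed.

(** The points of [A] that agree with [y] at level [i] form a nonempty closed set, shrinking as [i]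
    grows, so compactness yields a point of [A] agreeing with [y] at all levels. *)
Lemma inverse_limit_lift (X : topologicalType) (A : set X)
    (f : X -> inverse_limit S) (y : inverse_limit S) :
  compact [set: X] -> closed A ->
  (forall i, continuous (fun x => set_val (f x) i : discrete_topology (T i))) ->
  (forall i, exists2 x, A x & set_val (f x) i = set_val y i) ->
  exists2 x, A x & f x = y.
Proof.
move=> cptX A_closed f_cts fy.
have [|||||x xK] := @compact_directed_bigcap X d I
    (fun i => A `&` [set x | set_val (f x) i = set_val y i]) cptX.
- exact: index_inhabited S.
- exact: index_directed S.
- move=> i j ij x [Ax fxy]; split=> //=.
  rewrite -[LHS](set_valP (f x) i j ij) -[RHS](set_valP y i j ij).
  by congr (S i j ij _).
- move=> i; apply: closedI => //.
  have /continuous_closedP/(_ [set set_val y i]) := f_cts i; apply.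
  exact: discrete_closed.
- by move=> i; have [x Ax fxy] := fy i; exists x.
have [i0 _] := index_inhabited S.
exists x; first by have [] := xK i0.
by apply/val_inj/functional_extensionality_dep => i; have [] := xK i.
Qed.

Lemma inverse_limit_homeomorphism (X : topologicalType)
    (f : X -> inverse_limit S) :
  compact [set: X] -> injective f ->
  (forall i, continuous (fun x => set_val (f x) i : discrete_topology (T i))) ->
  (forall (y : inverse_limit S) i, exists x, set_val (f x) i = set_val y i) ->
  homeomorphism f.
Proof.
move=> cptX f_inj f_cts f_surj.
have f_onto (y : inverse_limit S) : exists x, f x = y.
  have [||x _ fxy] := @inverse_limit_lift X setT f y cptX _ f_cts.
  - exact: closedT.
  - by move=> i; have [x fxy] := f_surj y i; exists x.
  by exists x.
have [g fK] := choice f_onto; have gK x : g (f x) = x by exact: f_inj.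
exists g; split=> //; first exact: inverse_limit_continuous.
apply/continuous_closedP => C C_closed y cly /=.
(* A limit point [y] of the preimage of [C] under [g] agrees at each level with the image of a point
   of [C], so [y] itself lifts to [C]. *)
have [i|x Cx <-] := @inverse_limit_lift X C f y cptX C_closed f_cts; last first.
  by rewrite gK.
have [] := cly [set z | set_val z i = set_val y i].
  exact: (@inverse_limit_proj_continuous i y [set set_val y i]
    (@discrete_set1 (discrete_topology (T i)) _)).
by move=> z [/= Cz zy]; exists (g z); rewrite ?fK.
Qed.
End InverseLimit.

(** * Finite levels: discrete groups and image subgroups *)

Section DiscreteGroup.
Variable T : groupType.

(** [coset_quandle] expects a group with a topology; this alias equips an abstract group with the
    discrete one. *)
Definition discrete_group : Type := discrete_topology T.
HB.instance Definition _ :=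
  Topological.copy discrete_group (discrete_topology T).
HB.instance Definition _ := Group.copy discrete_group T.
End DiscreteGroup.

Section ImageSubgroup.
Context {G T : groupType} {p : G -> T}.

(* The proof [pM] is an argument of [image_pred], as of [kernel_pred] below, so
   that the subgroup structure can be inferred from the predicate. *)
Definition image_pred (pM : {morph p : x y / x * y}) (H : groupClosed G) :
  {pred T} := fun t => `[< exists2 x, x \in H & p x = t >].

Variables (pM : {morph p : x y / x * y}) (H : groupClosed G).

Lemma group_morph1 : p 1 = 1.
Proof. by apply: (@mulgI _ (p 1)); rewrite -pM !mulg1. Qed.

Lemma group_morphV x : p x^-1 = (p x)^-1.
Proof. by apply/esym/mulg1_eq; rewrite -pM mulgV group_morph1. Qed.

Lemma image_predP t : reflect (exists2 x, x \in H & p x = t)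
  (t \in image_pred pM H).
Proof. exact: asboolP. Qed.

Let image_predM : mulg_closed (image_pred pM H).
Proof.
move=> _ _ /image_predP[x xH <-] /image_predP[y yH <-].
by apply/image_predP; exists (x * y); rewrite ?gpredM ?pM.
Qed.

Let image_pred1 : 1 \in image_pred pM H.
Proof. by apply/image_predP; exists 1; rewrite ?gpred1 ?group_morph1. Qed.

Let image_predV : invg_closed (image_pred pM H).
Proof.
move=> _ /image_predP[x xH <-]; apply/image_predP.
by exists x^-1; rewrite ?gpredV ?group_morphV.
Qed.

HB.instance Definition _ := isMulClosed.Build T (image_pred pM H) image_predM.
HB.instance Definition _ := isMul1Closed.Build T (image_pred pM H) image_pred1.
HB.instance Definition _ := isInvClosed.Build T (image_pred pM H) image_predV.

Lemma center_image h : center H h -> center (image_pred pM H) (p h).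
Proof.
move=> [hH ch]; split; first by apply/image_predP; exists h.
by move=> _ /image_predP[x /ch hx <-]; rewrite /commute -!pM hx.
Qed.
End ImageSubgroup.

Lemma homeomorphism_compact (X Y : topologicalType) (f : X -> Y) :
  homeomorphism f -> compact [set: Y] -> compact [set: X].
Proof.
move=> [g [fK gK _ g_cts]] cptY.
rewrite (_ : [set: X] = g @` setT); last first.
  by apply/seteqP; split=> // x _; exists (f x).
by apply: continuous_compact => //; exact: continuous_subspaceT.
Qed.

(** * The coset quandle as a limit of finite coset quandles *)

Section CosetLimit.
Context {G : preTopologicalGroupType}.
Context {d} {I : porderType d} {T : I -> groupType}.
Variables (S : finite_group_system T) (f : G -> group_limit S).
Hypotheses (fM : {morph f : x y / x * y}) (f_homeo : homeomorphism f).
Context {H : groupClosed G} {h : G}.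
Hypotheses (closedH : closed [set` H]) (hZ : center H h).

Let p i (x : G) : discrete_group (T i) := group_proj i (f x).

Let pM i : {morph p i : x y / x * y}.
Proof. by move=> x y; rewrite /p fM. Qed.

Local Notation Q i := (coset_quandle (center_image (pM i) hZ)).

Let S_proj i j (ij : (i <= j)%O) x : S i j ij (p j x) = p i x.
Proof. exact: group_projE. Qed.

Let p_continuous i : continuous (p i : G -> discrete_topology (T i)).
Proof.
move=> x; have [g [_ _ f_cts _]] := f_homeo.
apply: (@continuous_comp _ (inverse_limit S) _ f (fun x => set_val x i)).
  exact: f_cts.
exact: inverse_limit_proj_continuous.
Qed.

Let G_compact : compact [set: G].
Proof.
apply: (homeomorphism_compact f_homeo).
exact/inverse_limit_compact/group_sys_finite.
Qed.

Let p_surj i t : exists x, p i x = t.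
Proof.
have [y <-] := inverse_limit_proj_surj S (group_sys_finite S) t.
by have [g [_ gK _ _]] := f_homeo; exists (g y); rewrite /p gK.
Qed.

Definition coset_transition i j (ij : (i <= j)%O) (a : Q j) : Q i :=
  \pi_(Q i) (S i j ij (repr a) : discrete_group (T i)).

(** The choice of representative is harmless: [S i j ij] carries the image of [H] in [T j] into its
    image in [T i]. *)
Let coset_transitionE i j (ij : (i <= j)%O) (t : discrete_group (T j)) :
  coset_transition ij (\pi_(Q j) t) =
  \pi_(Q i) (S i j ij t : discrete_group (T i)).
Proof.
apply/coset_quandleP; rewrite -[_^-1]group_sysV -[_ * _]group_sysM.
have /coset_quandleP/image_predP[x xH <-] := reprK (\pi_(Q j) t).
by apply/image_predP; exists x; rewrite ?S_proj.
Qed.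

Let coset_transition_id i (ii : (i <= i)%O) a : coset_transition ii a = a.
Proof. by rewrite /coset_transition transition_id reprK. Qed.

Let coset_transition_comp i j k (ij : (i <= j)%O) (jk : (j <= k)%O)
  (ik : (i <= k)%O) a :
  coset_transition ij (coset_transition jk a) = coset_transition ik a.
Proof.
elim/quotW: a => t.
rewrite (coset_transitionE jk) (coset_transitionE ij) (coset_transitionE ik).
by rewrite (transition_comp S ij jk ik).
Qed.

Let coset_transition_surj i j (ij : (i <= j)%O) a :
  exists b, coset_transition ij b = a.
Proof.
elim/quotW: a => t; have [u ut] := transition_surj S ij t.
by exists (\pi_(Q j) (u : discrete_group _)); rewrite coset_transitionE ut.
Qed.

Let coset_transitionM i j (ij : (i <= j)%O) :
  {morph coset_transition ij : a b / (a <| b)%Q >-> (a <| b)%Q}.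
Proof.
elim/quotW => t; elim/quotW => u.
rewrite coset_quandle_opE !coset_transitionE coset_quandle_opE.
congr (\pi_(Q i) _); rewrite -[p i h](S_proj ij).
by rewrite -[(S i j ij u : discrete_group _)^-1](group_sysV S) !(group_sysM S).
Qed.

Let Q_finite i : finite_set [set: Q i].
Proof.
pose q (t : T i) := \pi_(Q i) (t : discrete_group _).
rewrite (_ : [set: _] = q @` setT); first exact/finite_image/group_sys_finite.
by apply/seteqP; split=> // a _; exists (repr a) => //; exact: reprK.
Qed.

Definition coset_system : finite_quandle_system (fun i => Q i : quandleType) :=
  @FiniteQuandleSystem _ I (fun i => Q i)
    (InverseSystem (index_inhabited S) (index_directed S) coset_transition_id
      coset_transition_comp coset_transition_surj)
    Q_finite coset_transitionM.

Program Definition coset_limit_map (a : coset_quandle hZ) :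
    quandle_limit coset_system :=
  @SigSub _ _ _ (fun i => \pi_(Q i) (p i (repr a))) _.
Next Obligation.
move=> a; apply/mem_set => i j ij.
by rewrite [LHS]coset_transitionE S_proj.
Qed.

Lemma coset_limit_mapE i x :
  quandle_proj i (coset_limit_map (\pi_(coset_quandle hZ) x)) =
  \pi_(Q i) (p i x).
Proof.
apply/coset_quandleP; rewrite -(group_morphV (pM i)) -pM.
apply/image_predP; exists (repr (\pi_(coset_quandle hZ) x) / x) => //.
exact/(coset_quandleP hZ)/reprK.
Qed.

Lemma coset_limit_mapM : {morph coset_limit_map : a b / (a <| b)%Q}.
Proof.
elim/quotW => x; elim/quotW => y; apply: quandle_limit_ext => i.
rewrite coset_quandle_opE coset_limit_mapE.
rewrite -[RHS]/(quandle_proj i (coset_limit_map (\pi x)) <|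
  quandle_proj i (coset_limit_map (\pi y)))%Q.
by rewrite !coset_limit_mapE coset_quandle_opE !pM (group_morphV (pM i)).
Qed.

(** If the cosets of [x] and [y] agree at every level, then [x / y] agrees at each level with some
    element of [H]. As [H] is closed in a compact group, [x / y] lies in [H]. *)
Lemma coset_limit_map_inj : injective coset_limit_map.
Proof.
elim/quotW => x; elim/quotW => y xy; apply/coset_quandleP.
have [|i|] :=
  @inverse_limit_lift _ _ _ S G [set` H] f (f (x / y)) G_compact closedH.
- exact: p_continuous.
- have := congr1 (quandle_proj i) xy; rewrite !coset_limit_mapE.
  move=> /coset_quandleP; rewrite -(group_morphV (pM i)) -pM.
  by case/image_predP => z zH zxy; exists z.
move=> z zH; have [g [fK _ _ _]] := f_homeo.
by move=> /(can_inj fK) <-.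
Qed.

Lemma coset_limit_homeo : homeomorphism coset_limit_map.
Proof.
apply: (@inverse_limit_homeomorphism _ _ _ coset_system).
- rewrite (_ : [set: _] = \pi_(coset_quandle hZ) @` setT); last first.
    by by apply/seteqP; split=> // a _; exists (repr a) => //; exact: reprK.
  apply: continuous_compact => //; apply: continuous_subspaceT.
  exact: pi_continuous.
- exact: coset_limit_map_inj.
(* By the quotient topology, continuity is tested on [G], where the level map factors through the
   locally constant [p i]. *)
- move=> i; apply/quotient_continuous/continuous_discreteP => x.
  have nx : nbhs x [set z | p i z = p i x].
    exact: (@p_continuous i x [set p i x]
      (@discrete_set1 (discrete_topology (T i)) _)).
  apply: filterS nx => z /= zx.
  by rewrite [LHS]coset_limit_mapE [RHS]coset_limit_mapE zx.
- move=> y i; have [x xy] := @p_surj i (repr (quandle_proj i y)).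
  exists (\pi_(coset_quandle hZ) x); rewrite [LHS]coset_limit_mapE xy.
  exact: reprK.
Qed.
End CosetLimit.

(** * Generated subgroups and finiteness of self-maps *)

Lemma generated_ind (G : groupType) (A : set G) (P : G -> Prop) :
  P 1 -> (forall x y, P x -> P y -> P (x / y)) -> A `<=` P ->
  forall x, generated A x -> P x.
Proof.
move=> P1 PV AP x; apply; split=> //; split=> [|y z]; first exact/mem_set.
by move=> /set_mem Py /set_mem Pz; exact/mem_set/PV.
Qed.

(** An enumeration [s] of [T] encodes self-maps injectively as finite functions on [seq_sub s],
    which form a finite type. *)
Lemma finite_endo (T : choiceType) :
  finite_set [set: T] -> finite_set [set: T -> T].
Proof.
move=> /finite_seqP[s Ts].
have sT x : x \in s by have : [set: T] x by []; rewrite Ts.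
pose F (f : T -> T) := [ffun x : seq_sub s => SeqSub (sT (f (ssval x)))].
have F_inj : injective F.
  move=> f g /ffunP fg; apply/funext => x.
  by have := fg (SeqSub (sT x)); rewrite !ffunE => -[].
rewrite (_ : [set: _] = F @^-1` [set: _]); last exact/seteqP.
by apply: finite_preimage => // ? ? _ _ /F_inj.
Qed.

(** * Extending homomorphisms into finite groups to the completion *)

Section Kernel.
Context {G K : groupType} {p : G -> K}.
Variable pM : {morph p : x y / x * y}.

Definition kernel_pred of {morph p : x y / x * y} : {pred G} :=
  [pred x | p x == 1].
Local Notation ker := (kernel_pred pM).

Let kerP x : reflect (p x = 1) (x \in ker).
Proof. exact: eqP. Qed.

Let kerM : mulg_closed ker.
Proof. by move=> x y /kerP px /kerP py; apply/kerP; rewrite pM px py mulg1. Qed.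
Let ker1 : 1 \in ker.
Proof. exact/kerP/group_morph1. Qed.
Let kerV : invg_closed ker.
Proof.
by move=> x /kerP px; apply/kerP; rewrite (group_morphV pM) px invg1.
Qed.

HB.instance Definition _ := isMulClosed.Build G ker kerM.
HB.instance Definition _ := isMul1Closed.Build G ker ker1.
HB.instance Definition _ := isInvClosed.Build G ker kerV.

Let ker_normal x y : x \in ker -> x ^ y \in ker.
Proof.
move=> /kerP px; apply/kerP.
by rewrite conjgE !pM px mul1g -pM mulVg (group_morph1 pM).
Qed.

Lemma kernel_eqP x y : reflect (p x = p y) (x / y \in ker).
Proof.
apply: (iffP (kerP _)) => [|pxy]; rewrite pM (group_morphV pM).
  exact: divg1_eq.
by rewrite pxy mulgV.
Qed.

Hypothesis K_finite : finite_set [set: K].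

Let ker_finite : finite_set [set: right_cosets ker].
Proof.
rewrite (_ : [set: _] = (p \o repr) @^-1` [set: K]); last exact/seteqP.
apply: finite_preimage => // a b _ _ /= ab; rewrite -[a]reprK -[b]reprK.
exact/right_cosetsP/kernel_eqP.
Qed.

Definition kernel : finite_index_normal G :=
  @FiniteIndexNormal G ker ker_normal ker_finite.

(** The coordinate of [g] at the kernel of [p] is a coset on which [p] is constant; the extension
    takes that value, so it depends on one coordinate only. *)
Definition completion_extension (g : profinite_completion G) : K :=
  p (repr (group_proj kernel g)).

Lemma completion_extensionE g x :
  group_proj kernel g = \pi_(quotient_group kernel) x ->
  completion_extension g = p x.
Proof.
move=> gx; apply/kernel_eqP; apply/(quotient_groupP kernel).
by rewrite reprK gx.
Qed.

Lemma completion_extension_map x :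
  completion_extension (completion_map x) = p x.
Proof. exact: completion_extensionE. Qed.

Lemma completion_extensionM : {morph completion_extension : g g' / g * g'}.
Proof.
move=> g g'; rewrite -pM; apply: completion_extensionE.
by rewrite quotient_piM !reprK.
Qed.

Lemma completion_extension_continuous :
  continuous (completion_extension : _ -> discrete_topology K).
Proof.
apply: continuous_discreteP => g.
have ng : nbhs g [set g' | group_proj kernel g' = group_proj kernel g].
  exact: (@inverse_limit_proj_continuous _ _ _ (completion_system G) kernel g
    [set group_proj kernel g] (@discrete_set1 (discrete_topology _) _)).
by apply: filterS ng => g'; rewrite /completion_extension /= => ->.
Qed.
End Kernel.

(** * Inner automorphisms and the action of their completion *)

Lemma Inn_eq (Q : quandleType) (s t : Inn Q) : s =1 t -> s = t.
Proof. by move=> st; apply/val_inj/sym_eq. Qed.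

Lemma Inn_finite (Q : quandleType) :
  finite_set [set: Q] -> finite_set [set: Inn Q].
Proof.
move=> /finite_endo Q_finite.
rewrite (_ : [set: _] = (fun s : Inn Q => s : Q -> Q) @^-1` [set: _]).
  by apply: finite_preimage => // s t _ _ st; apply: Inn_eq => x; rewrite st.
exact/seteqP.
Qed.

Lemma Inn_ind (Q : quandleType) (P : sym Q -> Prop) :
  P 1 -> (forall s t, P s -> P t -> P (s / t)) -> (forall y, P (symmetry y)) ->
  forall s : Inn Q, P s.
Proof.
move=> P1 PV Psym [s /= /set_mem]; apply: generated_ind => // _ [y _ <-].
exact: Psym.
Qed.

Section CompletionAction.
Context {d} {I : porderType d} {T : I -> quandleType}.
Variable S : finite_quandle_system T.
Local Notation Q := (quandle_limit S).
Local Notation Inn_hat := (profinite_completion (Inn Q)).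

Let quandle_proj_surj i t : exists x : Q, quandle_proj i x = t.
Proof. exact: inverse_limit_proj_surj (quandle_sys_finite S) i t. Qed.

(** The symmetry at [y] descends to the symmetry at its projection, and descending permutations are
    closed under division. *)
Let inn_descends i (s : Inn Q) :
  exists t : Inn (T i), forall x, quandle_proj i (s x) = t (quandle_proj i x).
Proof.
pose P (s : sym Q) :=
  exists t : Inn (T i), forall x, quandle_proj i (s x) = t (quandle_proj i x).
have PV u v : P u -> P v -> P (u / v).
  move=> [u' uu'] [v' vv']; exists (u' / v') => x.
  rewrite -[RHS]/((inn_sym v')^-1 (u' (quandle_proj i x))).
  (* Writing [u x] as [v] applied to its preimage lets [v'] cancel against its inverse. *)
  by rewrite -uu' -{1}(sym_invK v (u x)) -[RHS]/(sym_inv v' _) vv' sym_funK.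
apply: (@Inn_ind Q P) => [||y]; [by exists 1|exact: PV|].
by exists (inn_symmetry (quandle_proj i y)).
Qed.

Definition inn_proj i (s : Inn Q) : Inn (T i) :=
  projT1 (cid (inn_descends i s)).

Lemma inn_projE i (s : Inn Q) x :
  quandle_proj i (s x) = inn_proj i s (quandle_proj i x).
Proof. by rewrite /inn_proj; case: cid. Qed.

(** Surjectivity of [quandle_proj i] determines the descended automorphism, so the choice in
    [inn_proj] is forced and yields a homomorphism. *)
Lemma inn_proj_unique i (s : Inn Q) (t : Inn (T i)) :
  (forall x, quandle_proj i (s x) = t (quandle_proj i x)) -> inn_proj i s = t.
Proof.
move=> st; apply: Inn_eq => u; have [x <-] := @quandle_proj_surj i u.
by rewrite -inn_projE st.
Qed.

Lemma inn_projM i : {morph inn_proj i : s t / s * t}.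
Proof.
move=> s t; apply: inn_proj_unique => x.
by rewrite -[(s * t) x]/(t (s x)) !inn_projE.
Qed.

Lemma inn_proj_symmetry i x :
  inn_proj i (inn_symmetry x) = inn_symmetry (quandle_proj i x).
Proof. exact: inn_proj_unique. Qed.

Let finite_inn i : finite_set [set: Inn (T i)].
Proof. exact/Inn_finite/quandle_sys_finite. Qed.

Definition inn_hat_proj i : Inn_hat -> Inn (T i) :=
  completion_extension (inn_projM i) (finite_inn i).

Lemma inn_hat_proj_extends i : extends_projection (inn_hat_proj i).
Proof.
split; first exact: completion_extensionM.
  exact: completion_extension_continuous.
by move=> x; rewrite /inn_hat_proj completion_extension_map inn_proj_symmetry.
Qed.

Program Definition completion_act (x : Q) (g : Inn_hat) : Q :=
  @SigSub _ _ _ (fun i => inn_hat_proj i g (quandle_proj i x)) _.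
Next Obligation.
move=> x g; apply/mem_set => i j ij.
pose Ker k := kernel (inn_projM k) (finite_inn k).
(* An [s] in [Inn Q] that represents [g] modulo both kernels acts like [g] at levels [i] and [j];
   compatibility then follows because [s] acts on [Q] itself. *)
pose s := repr (group_proj (fin_cap (Ker i) (Ker j)) g).
have gs k (leN : (Ker k <= fin_cap (Ker i) (Ker j))%O) :
    inn_hat_proj k g = inn_proj k s.
  exact/completion_extensionE/(esym (group_projE leN g)).
rewrite !gs; [|by apply/fin_leP => z /andP[]..].
by rewrite -!inn_projE quandle_projE.
Qed.

Lemma completion_actE i x g :
  quandle_proj i (completion_act x g) = inn_hat_proj i g (quandle_proj i x).
Proof. by []. Qed.

Lemma completion_actP : is_completion_action completion_act.
Proof.
by move=> i; exists (inn_hat_proj i) => //; exact: inn_hat_proj_extends.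
Qed.

(** The hypothesis is density of the orbit of [x] under [Inn Q]. Each [s] gives the element
    [completion_map s], and [inverse_limit_lift] assembles these levelwise solutions in the compact
    completion. *)
Lemma dense_orbit_single_orbit (x : Q) :
  (forall (y : Q) i,
    exists s : Inn Q, quandle_proj i (s x) = quandle_proj i y) ->
  single_orbit S.
Proof.
move=> x_dense; exists completion_act; first exact: completion_actP.
exists x; apply/seteqP; split=> // y _.
have [||i|i|g _ <-] :=
  @inverse_limit_lift _ _ _ S Inn_hat setT (completion_act x) y; last first.
- by exists g.
- have [s sy] := x_dense y i; exists (completion_map s) => //.
  rewrite -[RHS]sy inn_projE [LHS]completion_actE.
  by rewrite /inn_hat_proj completion_extension_map.
- apply: continuous_discreteP => g.
  have [_ e_cts _] := inn_hat_proj_extends i.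
  have ng : nbhs g [set g' | inn_hat_proj i g' = inn_hat_proj i g].
    exact: (e_cts g [set inn_hat_proj i g]
      (@discrete_set1 (discrete_topology _) _)).
  apply: filterS ng => g' /= gg'.
  by rewrite [LHS]completion_actE [RHS]completion_actE gg'.
- exact: closedT.
- exact: (inverse_limit_compact (group_sys_finite (completion_system (Inn Q)))).
Qed.
End CompletionAction.

(** * Profiniteness and connectedness of the coset quandle *)

Theorem theorem5p6 (G : preTopologicalGroupType) (profG : profinite_group G)
  (H : groupClosed G) (closedH : closed [set` H])
  (Delta : Type) (g : Delta -> G)
  (gP : bijective (fun delta => \pi_(right_cosets H) (g delta)))
  (h : G) (hZ : center H h)
  (genG : topologically_generates
            (range (fun delta => (g delta)^-1 * h * g delta))) :
  profinite_quandle (coset_quandle hZ) /\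
  algebraically_connected (coset_quandle hZ).
Proof.
split.
  have [d [I [T [S [f [fM f_homeo]]]]]] := profG.
  constructor; exact: (ProfinitePresentation
    (@coset_limit_mapM _ _ _ _ _ _ fM _ _ hZ)
    (coset_limit_homeo fM f_homeo closedH hZ)).
(* The presentation [P] is arbitrary and need not come from one of [G]; the argument uses only that
   [f] is a continuous morphism with right inverse [f']. *)
move=> P; have [f' [_ f'K f_cts _]] := pres_homeo P.
have fM := @pres_isoM _ P.
move: (pres_sys P) (pres_iso P) f' f'K f_cts fM => S f f' f'K f_cts fM.
pose piQ x : coset_quandle hZ := \pi_(coset_quandle hZ) x.
apply: (@dense_orbit_single_orbit _ _ _ S (f (piQ 1))) => y i.
(* Right translation of cosets by any [u] in the generated subgroup is induced by an inner
   automorphism. *)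
have genP u : generated (range (fun delta => (g delta)^-1 * h * g delta)) u ->
    exists s : Inn (quandle_limit S), forall z, s (f (piQ z)) = f (piQ (z * u)).
  move: u; apply: generated_ind => [|u v [s su] [t tv]|_ [delta _ <-]].
  - by exists 1 => z; rewrite mulg1.
  - exists (s / t) => z; rewrite -[LHS]/(sym_inv t (s (f (piQ z)))) su.
    (* Factoring [u] as [(u / v) * v] exhibits the point as an image under [t], which its inverse
       cancels. *)
    by rewrite -{1}[u](mulgVK v) mulgA -tv sym_funK mulgA.
  - exists (inn_symmetry (f (piQ (g delta)))) => z.
    by rewrite -[LHS]/(_ <| _)%Q -fM coset_quandle_opE !mulgA.
pose w := repr (f' y).
(* The elements of [G] whose coset agrees with [y] at level [i] form a neighbourhood of [w], so
   density puts some generated [u] there; its automorphism moves the base coset to that of [u]. *)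
have nw : nbhs w [set z | quandle_proj i (f (piQ z)) = quandle_proj i y].
  have piQ_cts : continuous (f \o piQ) by exact/quotient_continuous.
  apply: (piQ_cts w [set v | quandle_proj i v = quandle_proj i y]).
  rewrite /= /piQ reprK f'K.
  exact: (@inverse_limit_proj_continuous _ _ _ S i y [set quandle_proj i y]
    (@discrete_set1 (discrete_topology _) _)).
have : closure (generated (range (fun delta => (g delta)^-1 * h * g delta))) w.
  by rewrite [closure _]genG.
move=> /(_ _ nw)[u [/genP[s su] uy]].
by exists s; rewrite su mul1g.
Qed.
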